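(* Let $d\ge1$, let $X\neq\{0\}$ be a separable $F$-space, let $(T_a)_{a\in\mathbb R^d}$ be a strongly continuous operator group on $X$ and let $(\lambda_n)$ be an increasing sequence of positive real numbers such that $\liminf_{n\to\infty}\frac{\lambda_{n+1}}{\lambda_n}>1$. Then $\bigcap_{a\in\mathbb R^d\setminus\{0\}}HC(T_{\lambda_na})$ is empty.
   Context: A separable $F$-space is a separable topological vector space carrying a complete translation-invariant metric. An operator group $(T_a)_{a\in\mathbb R^d}$ on $X$ is a family of continuous linear operators on $X$ with $T_0=I$ and $T_{a+b}=T_aT_b$; it is strongly continuous if $a\mapsto T_af$ is continuous for each $f\in X$. For $a\in\mathbb R^d$, $HC(T_{\lambda_na})$ denotes the set of vectors $x\in X$ that are hypercyclic for the sequence of operators $(T_{\lambda_na})_n$, i.e. such that the set $\{T_{\lambda_na}x:\ n\}$ is dense in $X$. *)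

(* Defs.v *)
From mathcomp Require Import all_boot all_order all_algebra.
From mathcomp Require Import complex.
From mathcomp Require Import all_classical all_reals all_analysis.
Set Implicit Arguments.
Unset Strict Implicit.
Unset Printing Implicit Defensive.
Import Order.TTheory GRing.Theory Num.Theory.
Import numFieldNormedType.Exports.
Local Open Scope classical_set_scope.
Local Open Scope ring_scope.

Variant scalar_kind := RealScalars | ComplexScalars.

Definition scalars (R : realType) (k : scalar_kind) : numFieldType :=
  match k with RealScalars => R | ComplexScalars => R[i] end.

(* Nonnegativity of the distance follows from the first three clauses. No local
   convexity is assumed. *)
Record Fspace_metric (R : realType) (K : numDomainType)
    (X : topologicalLmodType K) (dist : X -> X -> R) : Prop := {
  dist_eq0 : forall x y, dist x y = 0 <-> x = y ;
  dist_sym : forall x y, dist x y = dist y x ;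
  dist_triangle : forall x y z, dist x z <= dist x y + dist y z ;
  dist_translation : forall x y z, dist (x + z) (y + z) = dist x y ;
  dist_topology : forall x : X,
    nbhs x = filter_from [set e : R | 0 < e] (fun e => [set y | dist x y < e]) ;
  dist_complete : forall u : nat -> X,
    (forall e : R, 0 < e -> exists N, forall m n,
       (N <= m)%N -> (N <= n)%N -> dist (u m) (u n) < e) ->
    exists l : X, u @ \oo --> l
}.

Definition Fspace (R : realType) (K : numDomainType)
    (X : topologicalLmodType K) : Prop :=
  exists dist : X -> X -> R, Fspace_metric dist.

Definition separable (X : topologicalType) :=
  exists2 D : set X, countable D & dense D.

Section OperatorGroups.
Context (R : realType) (K : numDomainType) (X : topologicalLmodType K).

Definition operator_group (d : nat) (T : 'rV[R]_d -> X -> X) :=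
  [/\ forall a, linear (T a), forall a, continuous (T a), T 0 = id
    & forall a b, T (a + b) = T a \o T b].

Definition strongly_continuous (d : nat) (T : 'rV[R]_d -> X -> X) :=
  forall f : X, continuous (fun a => T a f).

End OperatorGroups.

Definition HC (X : topologicalType) (S : nat -> X -> X) : set X :=
  [set x | dense (range (fun n => S n x))].

(* Main.v *)
Require Import Defs.
From mathcomp Require Import all_boot all_order all_algebra.
From mathcomp Require Import all_classical all_reals all_analysis.
From mathcomp Require Import lra.
Set Implicit Arguments.
Unset Strict Implicit.
Unset Printing Implicit Defensive.
Import Order.TTheory GRing.Theory Num.Theory.
Import numFieldNormedType.Exports.
Local Open Scope classical_set_scope.
Local Open Scope ring_scope.

(* Suppose x is hypercyclic for every direction, fix a direction e and put
   S_s = T_(s e). Density prevents x from being periodic under S: the orbit of a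
   periodic point is a compact set avoiding 0. By Baire's theorem (S_s) is
   equicontinuous for small s, so, given 0 < l < L, some ball U around x
   satisfies S_s U /\ U = 0 for all s in [l, L]. The set E of times s with
   S_s x in U is thus a union of clusters of diameter < l at mutual distance
   > L, and a nested interval argument yields t in [1, 2] such that lambda_n t
   avoids E for all n, contradicting hypercyclicity of x in the direction t e. *)

(** * Lacunary sequences avoiding a sparse set of times *)

Lemma expr_ge_linear (R : realType) (q : R) :
  1 < q -> exists m, (0 < m)%N /\ 2 * m%:R + 1 <= q ^+ m.
Proof.
move=> q1; set c := q - 1.
have c0 : 0 < c by rewrite subr_gt0.
have bernoulli n : n%:R * c <= q ^+ n - 1.
  elim: n => [|n IH]; first by rewrite mul0r expr0 subrr.
  have qn : 1 <= q ^+ n by rewrite exprn_ege1 // ltW.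
  rewrite exprS -[n.+1]addn1 natrD mulrDl mul1r /c in IH *.
  nra.
(* Squaring the Bernoulli bound [k c <= q^k] gives quadratic growth. With [m = 2k] and [k c^2 >= 5],
   it yields [q^m >= (k c)^2 >= 5k >= 4k + 1]. *)
have [k kP] : exists k : nat, 5 / c ^+ 2 <= k%:R.
  exists (Num.truncn (5 / c ^+ 2)).+1.
  by rewrite ltW // truncnS_gt.
have k0 : (0 < k)%N.
  by rewrite -(ltr_nat R); apply: lt_le_trans kP; rewrite divr_gt0 ?exprn_gt0.
exists (k + k)%N; split; first by rewrite addn_gt0 k0.
have qk : k%:R * c <= q ^+ k by apply: le_trans (bernoulli k) _; lra.
have : k%:R * c * (k%:R * c) <= q ^+ k * q ^+ k.
  by apply: ler_pM => //; rewrite mulr_ge0 // ltW.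
rewrite -exprD; apply: le_trans.
have kc : 5 <= k%:R * c ^+ 2 by rewrite -ler_pdivrMr // exprn_gt0.
have k1 : 1 <= k%:R :> R by rewrite ler1n.
rewrite natrD; rewrite expr2 in kc; nra.
Qed.

Section Lacunary.
Context (R : realType) (q Q : R) (m : nat) (mu : nat -> R) (E : set R).
Context (q1 : 1 < q) (Qm : Q = q ^+ m) (mQ : 2 * m%:R + 1 <= Q) (Q1 : 1 < Q).
Context (mu0 : 1 <= mu 0) (muS : forall n, q * mu n <= mu n.+1).
Context (sparse : forall s s',
  E s -> E s' -> `|s - s'| <= Q -> `|s - s'| < Q^-1).

Lemma lacunary_expr n k : q ^+ k * mu n <= mu (n + k)%N.
Proof.
elim: k => [|k IH]; first by rewrite expr0 mul1r addn0.
rewrite addnS exprS -mulrA; apply: le_trans (muS _).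
by rewrite ler_pM2l ?(lt_trans _ q1).
Qed.

Lemma lacunary_ge_expr n : q ^+ n <= mu n.
Proof.
have := lacunary_expr 0 n; rewrite add0n; apply: le_trans.
by rewrite ler_peMr // exprn_ge0 // ltW // (lt_trans _ q1).
Qed.

(** Multiplication by [mu n] would send a gap in [[Q^-(j+1), Q^-j]] into [[Q^-1, Q]], the range of
    distances that [sparse] forbids in [E]. *)
Lemma hit_separation (j n : nat) (t t' : R) :
  Q ^+ j <= mu n < Q ^+ j.+1 -> E (mu n * t) -> E (mu n * t') ->
  t' - t <= Q ^- j -> t' - t < Q ^- j.+1.
Proof.
move=> /andP[Qmu muQ] Et Et' tt'; rewrite ltNge; apply/negP => tt.
have Q0 : 0 < Q by rewrite (lt_trans _ Q1).
have Qj0 : 0 < Q ^+ j by rewrite exprn_gt0.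
have mu_ge0 : 0 < mu n by rewrite (lt_le_trans Qj0).
have t0 : 0 < t' - t by rewrite (lt_le_trans _ tt) // invr_gt0 exprn_gt0.
have nE : `|mu n * t' - mu n * t| = mu n * (t' - t).
  by rewrite -mulrBr ger0_norm // mulr_ge0 // ltW.
have le : `|mu n * t' - mu n * t| <= Q.
  have -> : Q = Q ^+ j.+1 * Q ^- j by rewrite exprS mulfK // gt_eqF.
  by rewrite nE ler_pM // ltW.
have := sparse Et' Et le; rewrite nE ltNge => /negP; apply.
have -> : Q^-1 = Q ^+ j * Q ^- j.+1.
  by rewrite exprSr invfM mulrA divff ?mul1r // gt_eqF.
by rewrite ler_pM // ?invr_ge0 ?exprn_ge0 // ltW.
Qed.

(* At most [m] terms of [mu] lie in [Q^j, Q^(j+1)), and each of them is bad for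
   at most one of the [m + 1] candidate subintervals, which are at mutual
   distance at least [Q^-(j+1)]. *)
Lemma avoid_block (j : nat) (a : R) : exists a',
  [/\ a <= a', a' + Q ^- j.+1 <= a + Q ^- j &
     forall n t, Q ^+ j <= mu n < Q ^+ j.+1 -> a' <= t <= a' + Q ^- j.+1 ->
       ~ E (mu n * t)].
Proof.
apply: contrapT => noa.
have Q0 : 0 < Q by rewrite (lt_trans _ Q1).
set h := Q ^- j.+1 in noa *.
have h0 : 0 < h by rewrite invr_gt0 exprn_gt0.
have Qh : Q ^- j = Q * h by rewrite /h exprS invfM mulrA divff ?mul1r // gt_eqF.
(* The candidates are [[a + 2ih, a + (2i+1)h]] for [i <= m]. They fit because
   [(2m+1)h <= Qh = Q^-j]. If the lemma fails, every one of them is hit. *)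
have hit (i : 'I_m.+1) : exists nt : nat * R,
    [/\ Q ^+ j <= mu nt.1 < Q ^+ j.+1,
     a + (2 * i%:R) * h <= nt.2 <= a + (2 * i%:R) * h + h &
     E (mu nt.1 * nt.2)].
  apply: contrapT => nohit; apply: noa.
  exists (a + (2 * i%:R) * h); split.
  - by rewrite lerDl mulr_ge0 ?mulr_ge0 // ltW.
  - have im : i%:R <= m%:R :> R by rewrite ler_nat -ltnS.
    rewrite -addrA lerD2l Qh -{2}[h]mul1r -mulrDl ler_pM2r //.
    by apply: le_trans mQ; rewrite lerD2r ler_pM2l.
  - by move=> n t nB tI Et; apply: nohit; exists (n, t).
have [nt /= ntP] := choice hit.
(* From the first index [n0] of the block, [m] steps multiply [mu] by at least [q^m = Q] and so
   leave the block. The [m + 1] hits thus share [m] indices, and the pigeonhole principle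
   applies. *)
have /ex_minnP[n0 n0Q n0min] : exists n, Q ^+ j <= mu n.
  by exists (nt ord0).1; have [/andP[]] := ntP ord0.
have ntn i : (n0 <= (nt i).1 < n0 + m)%N.
  have [/andP[lo hi] _ _] := ntP i.
  rewrite n0min //= ltnNge; apply/negP => le; move: hi; apply/negP.
  rewrite -leNgt -(subnKC le) -addnA; apply: le_trans (lacunary_expr _ _).
  rewrite exprS Qm exprD -Qm; apply: ler_pM => //; try exact: exprn_ge0 (ltW _).
    by rewrite ltW.
  by rewrite ler_peMr ?exprn_ege1 ?ltW // exprn_gt0 // (lt_trans _ q1).
have gP i : ((nt i).1 - n0 < m)%N.
  by have /andP[? ?] := ntn i; rewrite ltn_subLR.
pose g i : 'I_m := Ordinal (gP i).
suff /leq_card : injective g by rewrite !card_ord ltnn.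
have lt_absurd i i' : g i = g i' -> (i < i')%N -> False.
  move=> /(congr1 (@nat_of_ord m)) /= gii' ii'.
  have nn : (nt i').1 = (nt i).1.
    have /andP[? _] := ntn i; have /andP[? _] := ntn i'.
    by rewrite -[LHS](subnK (m := n0)) // -gii' subnK.
  have [B /andP[lo hi] Et] := ntP i; have [_ /andP[lo' hi'] Et'] := ntP i'.
  rewrite nn in Et'.
  have i'i : i%:R + 1 <= i'%:R :> R by rewrite natr1 ler_nat.
  have i'm : i'%:R <= m%:R :> R by rewrite ler_nat -ltnS.
  have i0 : 0 <= i%:R :> R by [].
  have ub : (nt i').2 - (nt i).2 <= Q ^- j.
    rewrite Qh; have : (2 * m%:R + 1) * h <= Q * h by rewrite ler_pM2r.
    have : i'%:R * h <= m%:R * h by rewrite ler_pM2r.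
    have : 0 <= i%:R * h by rewrite mulr_ge0 // ltW.
    lra.
  have := hit_separation B Et Et' ub; rewrite -/h ltNge => /negP; apply.
  have : (i%:R + 1) * h <= i'%:R * h by rewrite ler_pM2r.
  lra.
move=> i i' gii'; apply: val_inj; case: (ltngtP i i') => // ltii'.
  by case: (lt_absurd _ _ gii' ltii').
by case: (lt_absurd _ _ (esym gii') ltii').
Qed.

(** Iterating [avoid_block] from [[1, 2]] gives nested intervals [[a j, a j + Q^-j]]. The supremum
    of the left endpoints lies in all of them, hence avoids every block. *)
Lemma avoid_nested : exists t, 1 <= t <= 2 /\ forall n, ~ E (mu n * t).
Proof.
have Q0 : 0 < Q by rewrite (lt_trans _ Q1).
have [next nextP] := choice (fun ja : nat * R => avoid_block ja.1 ja.2).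
pose a := fix a j := if j is i.+1 then next (i, a i) else 1.
have a_step j : a j <= a j.+1 by have [] := nextP (j, a j).
have b_step j : a j.+1 + Q ^- j.+1 <= a j + Q ^- j by have [] := nextP (j, a j).
have a_avoid j n t : Q ^+ j <= mu n < Q ^+ j.+1 ->
    a j.+1 <= t <= a j.+1 + Q ^- j.+1 -> ~ E (mu n * t).
  by have [_ _ +] := nextP (j, a j); apply.
have a_mono j k : (j <= k)%N -> a j <= a k.
  by move=> jk; apply/nondecreasing_seqP : (j) (k) jk.
have b_mono j k : (j <= k)%N -> a k + Q ^- k <= a j + Q ^- j.
  move=> /subnKC <-; elim: (k - j)%N => [|i IH]; first by rewrite addn0.
  by rewrite addnS; apply: le_trans IH.
have ab j k : a j <= a k + Q ^- k.
  have pos i : a i <= a i + Q ^- i by rewrite lerDl invr_ge0 exprn_ge0 // ltW.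
  have [jk|/ltnW kj] := leqP j k; first exact: le_trans (a_mono _ _ jk) (pos k).
  exact: le_trans (pos j) (b_mono _ _ kj).
have supa : has_sup (range a).
  by split; [exists (a 0), 0%N | exists (a 0 + Q ^- 0) => _ [j _ <-]].
have at_ j : a j <= sup (range a) <= a j + Q ^- j.
  apply/andP; split; first by apply: ub_le_sup; [case: supa | exists j].
  by apply: ge_sup; [case: supa | move=> _ [k _ <-]].
exists (sup (range a)); split.
  by have := at_ 0; rewrite expr0 invr1.
move=> n.
(* The least such [j] is nonzero because [mu n >= q^n >= 1], so [mu n] lies in the block of index
   [j - 1]. *)
have /ex_minnP[j jP jmin] : exists j, mu n < Q ^+ j.
  have [k] : exists k : nat, mu n * (Q - 1)^-1 < k%:R.
    by exists (Num.truncn (mu n * (Q - 1)^-1)).+1; rewrite truncnS_gt.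
  rewrite ltr_pdivrMr ?subr_gt0 // => nk; exists k; apply: lt_le_trans nk _.
  elim: k => [|k IH]; first by rewrite mul0r exprn_ge0 // ltW.
  have Qk : 1 <= Q ^+ k by rewrite exprn_ege1 // ltW.
  have : 0 <= (Q - 1) * (Q ^+ k - 1) by rewrite mulr_ge0 // subr_ge0 // ltW.
  rewrite exprS -[k.+1]addn1 natrD; lra.
case: j jP jmin => [|j] jP jmin.
  move: jP; rewrite expr0 ltNge (le_trans _ (lacunary_ge_expr n)) //.
  by rewrite exprn_ege1 // ltW.
apply: (a_avoid j); last exact: at_.
by rewrite jP andbT leNgt; apply/negP => /jmin; rewrite ltnn.
Qed.

End Lacunary.

(** [Q] is fixed before [mu] and [E], since the set [E] of return times will come from a ball whose
    radius depends on [Q]. *)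
Lemma lacunary_avoid (R : realType) (q : R) : 1 < q ->
  exists2 Q : R, 2 <= Q & forall (mu : nat -> R) (E : set R),
    1 <= mu 0 -> (forall n, q * mu n <= mu n.+1) ->
    (forall s s', E s -> E s' -> `|s - s'| <= Q -> `|s - s'| < Q^-1) ->
    exists t, 1 <= t <= 2 /\ forall n, ~ E (mu n * t).
Proof.
move=> q1; have [m [m0 mQ]] := expr_ge_linear q1.
have m1 : 1 <= m%:R :> R by rewrite ler1n.
exists (q ^+ m) => [|mu E mu0 muS sparse]; first lra.
by apply: (@avoid_nested R q (q ^+ m) m) => //; lra.
Qed.

(** * The metric of an F-space and Baire's theorem *)

Section FspaceMetric.
Context (R : realType) (K : numDomainType) (X : topologicalLmodType K).
Context (dist : X -> X -> R) (dP : Fspace_metric dist).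

Lemma distxx x : dist x x = 0.
Proof. exact/(dist_eq0 dP). Qed.

Lemma dist_ge0 x y : 0 <= dist x y.
Proof.
have := dist_triangle dP x y x.
rewrite distxx (dist_sym dP y x) -mulr2n pmulrn_lge0 //.
Qed.

Lemma dist_gt0 x y : x <> y -> 0 < dist x y.
Proof.
by move=> xy; rewrite lt0r dist_ge0 andbT; apply/eqP => /(dist_eq0 dP).
Qed.

Lemma dist_sub x y : dist x y = dist 0 (y - x).
Proof. by rewrite -(dist_translation dP x y (- x)) subrr. Qed.

Lemma near_dist x e : 0 < e -> \forall y \near x, dist x y < e.
Proof.
move=> e0; have : nbhs x [set y | dist x y < e]; last by [].
by rewrite (dist_topology dP); exists e.
Qed.

Lemma dist_near_ball x (P : X -> Prop) : (\forall y \near x, P y) ->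
  exists2 e, 0 < e & forall y, dist x y < e -> P y.
Proof.
move=> xP; have : nbhs x P by [].
by rewrite (dist_topology dP) => -[e e0 eP]; exists e.
Qed.

Lemma dense_dist (D : set X) y e : dense D -> 0 < e ->
  exists2 z, D z & dist y z < e.
Proof.
move=> dD e0; have ye : nbhs y [set z | dist y z < e] by exact: near_dist.
have [|z [/interior_subset yz Dz]] :=
  dD [set z | dist y z < e]° _ (open_interior _); first by exists y.
by exists z.
Qed.

Lemma dist_continuous (f : R -> X) y : continuous f ->
  continuous (fun s => dist y (f s)).
Proof.
move=> cf s; apply/cvgrPdist_lt => e e0.
have sf : \forall t \near s, dist (f s) (f t) < e.
  exact: (cf s _ (near_dist (f s) e0)).
near=> t; apply: (@le_lt_trans _ _ (dist (f s) (f t))); last by near: t.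
have := dist_triangle dP y (f s) (f t); have := dist_triangle dP y (f t) (f s).
by rewrite (dist_sym dP (f t)) ler_norml => ? ?; apply/andP; split; lra.
Unshelve. all: by end_near. Qed.

Lemma Fspace_Baire (G : nat -> set X) :
  (forall k, closed (G k)) -> (forall x, exists k, G k x) ->
  exists k y, exists2 r, 0 < r & forall z, dist y z < r -> G k z.
Proof.
move=> clG covG; apply: contrapT => nG.
(* Positivity of the radius is a premise under the existential, so that [choice] gives a total step
   function; on nonpositive radii its value is arbitrary. *)
have shrink (kcr : nat * (X * R)) : exists c'r' : X * R, 0 < kcr.2.2 ->
    [/\ 0 < c'r'.2, c'r'.2 <= kcr.2.2 / 2 & forall z, dist c'r'.1 z <= c'r'.2 ->
        dist kcr.2.1 z <= kcr.2.2 /\ ~ G kcr.1 z].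
  case: kcr => k [c r] /=; have [r0|] := ltP 0 r; last by exists (c, r).
  have [z cz nGz] : exists2 z, dist c z < r / 2 & ~ G k z.
    apply: contrapT => nz; apply: nG; exists k, c, (r / 2); first by lra.
    by move=> z cz; apply: contrapT => nGz; apply: nz; exists z.
  have : \forall y \near z, (~` G k) y.
    by apply: open_nbhs_nbhs; split; [exact: closed_openC | exact: nGz].
  move=> /dist_near_ball[e e0 eG]; exists (z, Num.min (r / 2) (e / 2)) => _ /=.
  split; [by rewrite lt_min; apply/andP; split; lra | by rewrite ge_min lexx |].
  move=> y; rewrite le_min => /andP[zr ze]; split.
    by have := dist_triangle dP c z y; lra.
  by apply: eG; lra.
have [next nextP] := choice shrink.
pose cr := fix cr n := if n is k.+1 then next (k, cr k) else (0 : X, 1 : R).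
have r0 n : 0 < (cr n).2.
  by elim: n => [|n IH]; [exact: ltr01 | have [] := nextP (n, cr n) IH].
have step n : [/\ 0 < (cr n.+1).2, (cr n.+1).2 <= (cr n).2 / 2 &
    forall z, dist (cr n.+1).1 z <= (cr n.+1).2 ->
      dist (cr n).1 z <= (cr n).2 /\ ~ G n z].
  exact: (nextP (n, cr n) (r0 n)).
(* Halving gives geometric decay, but the bound [1/(n+1)] is enough to make the centres a Cauchy
   sequence. *)
have r_small n : (cr n).2 * n.+1%:R <= 1.
  elim: n => [|n IH]; first by rewrite mulr1.
  have [_ half _] := step n; have n0 : 0 <= n%:R :> R by [].
  have := r0 n; have := r0 n.+1; rewrite -!natr1 in IH *; nra.
have nested N k z : dist (cr (N + k)%N).1 z <= (cr (N + k)%N).2 ->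
    dist (cr N).1 z <= (cr N).2.
  elim: k => [|k IH]; first by rewrite addn0.
  by rewrite addnS => kz; apply: IH; have [_ _ /(_ _ kz)[]] := step (N + k)%N.
have inball N n : (N <= n)%N -> dist (cr N).1 (cr n).1 <= (cr N).2.
  move=> /subnKC <-; apply: (nested _ (n - N)%N).
  by rewrite distxx ltW.
have [e e0|l lP] := dist_complete dP (u := fun n => (cr n).1).
  exists (Num.truncn (2 / e)) => i j Ni Nj; set N := Num.truncn _ in Ni Nj.
  have eN : 2 / e < N.+1%:R by rewrite truncnS_gt.
  have NN := r_small N; have rN := r0 N.
  have : (cr N).2 < e / 2.
    rewrite ltr_pdivrMr // in eN; rewrite -subr_gt0; nra.
  have := dist_triangle dP (cr i).1 (cr N).1 (cr j).1.
  have := inball _ _ Ni; have := inball _ _ Nj.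
  rewrite (dist_sym dP (cr i).1 (cr N).1); lra.
have lball N : dist (cr N).1 l <= (cr N).2.
  apply/ler_addgt0Pr => e e0.
  have [M _ MP] := lP _ (near_dist l e0).
  have := MP _ (leq_maxr N M); rewrite /= (dist_sym dP) => le.
  have := inball N _ (leq_maxl N M).
  by have := dist_triangle dP (cr N).1 (cr (maxn N M)).1 l; lra.
by have [k Gkl] := covG l; have [_ _ /(_ _ (lball k.+1))[]] := step k.
Qed.

End FspaceMetric.

(** * One-parameter operator groups: equicontinuity and non-recurrence *)

Section OneParameterGroup.
Context (R : realType) (K : numDomainType) (X : topologicalLmodType K).
Context (dist : X -> X -> R) (dP : Fspace_metric dist).
Context (S : R -> X -> X).
Context (Sadd : forall s x y, S s (x + y) = S s x + S s y).
Context (Scont : forall s, continuous (S s)).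
Context (S0 : forall x, S 0 x = x).
Context (SD : forall s t x, S (s + t) x = S s (S t x)).
Context (orbit_cont : forall x, continuous (fun s => S s x)).

Lemma operator0 s : S s 0 = 0.
Proof. by apply: (@addrI _ (S s 0)); rewrite -Sadd !addr0. Qed.

Lemma displacement_continuous s : continuous (fun y => dist y (S s y)).
Proof.
move=> y; apply/cvgrPdist_lt => e e0.
have e2 : 0 < e / 2 by lra.
have yS : \forall z \near y, dist (S s y) (S s z) < e / 2.
  exact: (Scont (near_dist dP (S s y) e2)).
near=> z.
have : dist y z < e / 2 by near: z; exact: (near_dist dP).
have : dist (S s y) (S s z) < e / 2 by near: z.
have := dist_triangle dP y z (S s z).
have := dist_triangle dP y (S s z) (S s y).
have := dist_triangle dP z y (S s y).
have := dist_triangle dP z (S s y) (S s z).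
rewrite (dist_sym dP z y) (dist_sym dP (S s z) (S s y)) => *.
by rewrite ltr_norml; apply/andP; split; lra.
Unshelve. all: by end_near. Qed.

(** The closed sets [G k] of points moved by at most [e/4] during times [|s| <= 1/(k+1)] cover [X]
    by continuity of orbits, so one contains a ball around some [y]. By additivity, comparing [y]
    with [y + z] shows that a small [z] moves by at most [e/2]. *)
Lemma local_equicontinuity e : 0 < e -> exists2 h, 0 < h &
  exists2 r, 0 < r &
    forall s z, `|s| <= h -> dist 0 z < r -> dist 0 (S s z) < e.
Proof.
move=> e0.
pose G k := \bigcap_(s in [set s : R | `|s| <= k.+1%:R^-1])
  (fun y => dist y (S s y)) @^-1` [set u | u <= e / 4].
have [k||k [y [r r0 yG]]] := Fspace_Baire dP (G := G).
- apply: closed_bigI => s _; apply: preimage_closed; last exact: closed_le.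
  by move=> y _; exact: displacement_continuous.
- move=> x.
  have : \forall s \near 0, dist x (S s x) < e / 4.
    have e4 : 0 < e / 4 by lra.
    by have := @orbit_cont x 0 _ (near_dist dP (S 0 x) e4); rewrite /= S0.
  move=> /nbhs_ballP[h /= h0 hP]; exists (Num.truncn h^-1) => s /= sk.
  apply/ltW/hP; rewrite /ball /= sub0r normrN; apply: le_lt_trans sk _.
  by rewrite invf_plt ?posrE ?ltr0n // truncnS_gt.
exists k.+1%:R^-1; first by rewrite invr_gt0.
exists (Num.min r (e / 4)) => [|s z sk]; first by rewrite lt_min r0; lra.
rewrite lt_min => /andP[zr ze].
have yy : dist y (S s y) <= e / 4 by apply: (yG y) => //; rewrite (distxx dP).
have zz : dist (y + z) (S s (y + z)) <= e / 4.
  apply: (yG (y + z)) => //.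
  by rewrite (dist_sub dP) addrAC subrr add0r.
rewrite Sadd in zz.
have eq1 : dist (y + S s z) (S s y + S s z) = dist y (S s y).
  exact: dist_translation dP _ _ _.
have eq2 : dist (y + z) (y + S s z) = dist z (S s z).
  by rewrite ![y + _]addrC; exact: dist_translation dP _ _ _.
have := dist_triangle dP 0 z (S s z).
have := dist_triangle dP (y + z) (S s y + S s z) (y + S s z).
rewrite (dist_sym dP (S s y + S s z)) eq1 eq2; lra.
Qed.

(** Each [s] in [[l, L]] has a neighbourhood of times on which all points close to [x] are sent away
    from [x]. Compactness of [[l, L]], in its near-covering form, makes the radius uniform. *)
Lemma nonrecurrent_ball x l L : 0 < l ->
  (forall s, l <= s <= L -> S s x <> x) ->
  exists2 r, 0 < r &
    forall s y, l <= s <= L -> dist x y < r -> r <= dist x (S s y).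
Proof.
move=> l0 ap.
have : \forall r \near 0^'+, `[l, L]%classic `<=`
    (fun s => forall y, dist x y < r -> r <= dist x (S s y)).
  apply: (iffLR (compact_near_coveringP _) (segment_compact (a := l) (b := L))).
  move=> s.
  rewrite /= in_itv /= => sl.
  have d0 : 0 < dist x (S s x) by apply: (dist_gt0 dP) => /esym; exact: ap.
  set d := dist x (S s x) in d0.
  have d4 : 0 < d / 4 by lra.
  have [h h0 [r r0 hr]] := local_equicontinuity d4.
  have s_cont : \forall y \near x, dist (S s x) (S s y) < r.
    exact: (Scont (near_dist dP (S s x) r0)).
  have [r' r'0 r'P] := dist_near_ball dP s_cont.
  near=> t u => y /= xy.
  have st : dist (S s x) (S t x) < d / 4.
    by near: t; exact: (@orbit_cont x s _ (near_dist dP (S s x) d4)).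
  have tx : dist (S t x) (S t y) < d / 4.
    (* Equicontinuity is known only near time 0, so [S t] is factored through the fixed operator
       [S s]. *)
    have tS z : S t z = S (t - s) (S s z) by rewrite -SD subrK.
    have eqz : S (t - s) (S s y) =
        S (t - s) (S s x) + S (t - s) (S s y - S s x).
      by rewrite -Sadd [S s x + _]addrC subrK.
    rewrite !tS eqz (dist_sub dP) addrAC subrr add0r; apply: hr.
      near: t; exists h => //= t; rewrite /= distrC => /ltW //.
    rewrite -(dist_sub dP); apply: r'P; apply: lt_le_trans xy _.
    by near: u; exact: nbhs_right_le.
  have ud : u <= d / 4 by near: u; exact: nbhs_right_le.
  have := dist_triangle dP x (S t y) (S s x).
  have := dist_triangle dP (S t y) (S t x) (S s x).
  rewrite (dist_sym dP (S t y) (S t x)) (dist_sym dP (S t x) (S s x)) -/d; lra.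
move=> near_r; near (0 : R)^'+ => r.
exists r; first by near: r; exact: nbhs_right_gt.
move=> s y sl; have : `[l, L]%classic s by rewrite /= in_itv.
by move: s sl y; near: r; apply: filterS near_r => r rP s _ y /rP; apply.
Unshelve. all: by end_near. Qed.

(** The distance to 0 attains its minimum over one period, and this is positive: each [S c] is
    invertible, so [S c x = 0] would force [x = 0]. *)
Lemma periodic_orbit_away_from_0 x p : 0 < p -> S p x = x -> x <> 0 ->
  exists2 e, 0 < e & forall s, 0 <= s -> e <= dist 0 (S s x).
Proof.
move=> p0 px x0.
have per n : S (n%:R * p) x = x.
  elim: n => [|n IH]; first by rewrite mul0r S0.
  by rewrite -natr1 mulrDl mul1r SD px.
have cd : {within `[0, p], continuous (fun s => dist 0 (S s x))}.
  by apply: continuous_subspaceT; exact: (dist_continuous dP).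
have [c _ cmin] := EVT_min (ltW p0) cd.
exists (dist 0 (S c x)) => [|s s0].
  apply: (dist_gt0 dP) => c0; apply: x0.
  by rewrite -[LHS]S0 -(addNr c) SD -c0 operator0.
have sp : 0 <= s / p by rewrite divr_ge0 // ltW.
have /andP[lo hi] := truncn_itv sp; set n := Num.truncn _ in lo hi.
rewrite ler_pdivlMr // in lo; rewrite ltr_pdivrMr // -natr1 mulrDl mul1r in hi.
rewrite -(subrK (n%:R * p) s) SD per; apply: cmin.
by rewrite in_itv /=; apply/andP; split; lra.
Qed.

End OneParameterGroup.

(** * The lower limit condition and the proof of the theorem *)

Lemma limn_einf_gt_ex (R : realType) (u : nat -> R) (c : R) :
  (c%:E < limn_einf (fun n => (u n)%:E))%E ->
  exists2 q, c < q & exists N, forall n, (N <= n)%N -> q <= u n.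
Proof.
rewrite limn_einf_lim (cvg_lim _ (@cvg_einfs_sup _ _)) //.
move=> /ereal_sup_gt[_ [N _ <-]]; rewrite /einfs /=.
set I := ereal_inf _ => cI.
have Iu n : (N <= n)%N -> (I <= (u n)%:E)%E.
  by move=> Nn; apply: ereal_inf_lbound; exists n.
(* A finite tail infimum serves as [q]; the value [+oo] is excluded by the term [u N], and [-oo] by
   [cI]. *)
move: I cI Iu => [q||] //.
- rewrite lte_fin => cq Iu; exists q => //.
  by exists N => n /Iu; rewrite lee_fin.
- by move=> _ /(_ N (leqnn N)).
Qed.

Theorem theorem1p2 (R : realType) (k : scalar_kind) (d : nat)
    (X : topologicalLmodType (scalars R k))
    (T : 'rV[R]_d -> X -> X) (lambda : nat -> R) :
  (1 <= d)%N ->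
  [set: X] <> [set 0] ->
  Fspace R X ->
  separable X ->
  operator_group T ->
  strongly_continuous T ->
  (forall n, 0 < lambda n) ->
  increasing_seq lambda ->
  (1%:E < limn_einf (fun n => (lambda n.+1 / lambda n)%:E))%E ->
  \bigcap_(a in [set a : 'rV[R]_d | a != 0])
     HC (fun n => T (lambda n *: a)) = set0.
Proof.
move=> d1 X0 [dist dP] _ [Tlin Tcont T0 TD] Tsc lam0 laminc.
move=> /limn_einf_gt_ex[q q1 [N qN]].
apply/seteqP; split => // x xHC; exfalso.
pose e : 'rV[R]_d := const_mx 1.
have e0 : e != 0.
  apply/eqP => /matrixP/(_ ord0 (Ordinal d1)); rewrite !mxE.
  by move/eqP; rewrite oner_eq0.
(* Time is measured in units of [lambda N], so that the tail [lambda (N + n) / lambda N] starts at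
   1, as [lacunary_avoid] requires. *)
pose S s := T ((s * lambda N) *: e).
have Sadd s y z : S s (y + z) = S s y + S s z.
  by have := Tlin ((s * lambda N) *: e) 1 y z; rewrite !scale1r.
have Scont s : continuous (S s) by exact: Tcont.
have S0 y : S 0 y = y by rewrite /S mul0r scale0r T0.
have SD s t y : S (s + t) y = S s (S t y).
  by rewrite /S mulrDl scalerDl TD.
have orbit_cont y : continuous (fun s => S s y).
  move=> s; have line : (t * lambda N) *: e @[t --> s] --> (s * lambda N) *: e.
    by apply: cvgZr_tmp; exact: mulrr_continuous.
  exact: cvg_comp line (Tsc y _).
have ST n t : T (lambda n *: (t *: e)) = S (lambda n * t / lambda N).
  by rewrite /S divfK ?gt_eqF // scalerA.
have x_dense t y r : 0 < t -> 0 < r ->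
    exists n, dist y (S (lambda n * t / lambda N) x) < r.
  move=> t0 r0; have te : t *: e != 0 by rewrite scaler_eq0 negb_or gt_eqF.
  have [_ [n _ <-]] := dense_dist dP y (xHC _ te) r0.
  by rewrite /= ST; exists n.
have x0 : x <> 0.
  move=> x0; apply: X0; apply/seteqP; split => // y _ /=; apply: contrapT => y0.
  have [n] := x_dense 1 y _ ltr01 (dist_gt0 dP y0).
  by rewrite x0 operator0 // ltxx.
have aperiodic p : 0 < p -> S p x <> x.
  move=> p0 px; have [c c0 cP] :=
    periodic_orbit_away_from_0 dP Sadd S0 SD orbit_cont p0 px x0.
  have [n] := x_dense 1 0 c ltr01 c0; rewrite ltNge => /negP; apply; apply: cP.
  by rewrite mulr1 divr_ge0 // ltW.
have [Q Q2 QP] := lacunary_avoid q1.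
have Q0 : 0 < Q by lra.
(* As [S 0 x = x], the second term of the minimum keeps the times attached to
   the finitely many [n < N] away from the ball as well. *)
pose l := Num.min Q^-1 (lambda 0 / lambda N).
have l0 : 0 < l by rewrite lt_min invr_gt0 Q0 divr_gt0.
have [r r0 rP] := nonrecurrent_ball dP Sadd Scont S0 SD orbit_cont (x := x)
  (L := Q) l0 (fun s sl => aperiodic s (lt_le_trans l0 (proj1 (andP sl)))).
have [||s s'|t [/andP[t1 t2] tP]] :=
    QP (fun n => lambda (N + n)%N / lambda N) [set s | dist x (S s x) < r].
- by rewrite addn0 divff ?gt_eqF.
- move=> n; rewrite mulrA ler_pM2r ?invr_gt0 // addnS -ler_pdivlMr //.
  by apply: qN; rewrite leq_addr.
(* Since [S s2 x = S (s2 - s1) (S s1 x)] with [S s1 x] in the ball, a difference in [[Q^-1, Q]]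
   would put [S s2 x] outside it. *)
- have far s1 s2 : dist x (S s1 x) < r -> dist x (S s2 x) < r ->
      s2 - s1 <= Q -> s2 - s1 < Q^-1.
    move=> xs1 xs2 sQ; rewrite ltNge; apply/negP => Qs.
    suff : r <= dist x (S s2 x) by rewrite leNgt xs2.
    rewrite -(subrK s1 s2) SD; apply: rP => //.
    by rewrite sQ andbT ge_min Qs.
  move=> /= xs xs'; rewrite ler_norml ltr_norml => /andP[? ?].
  apply/andP; split; last exact: far.
  by rewrite ltrNl opprB; apply: far => //; rewrite -opprB lerNl.
have [n nt] := x_dense t x r (lt_le_trans ltr01 t1) r0.
have [Nn|nN] := leqP N n.
  apply: (tP (n - N)%N); rewrite /= subnKC // mulrAC //.
suff : r <= dist x (S (lambda n * t / lambda N) x) by rewrite leNgt nt.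
apply: rP; last by rewrite distxx.
apply/andP; split.
  rewrite ge_min; apply/orP; right; rewrite ler_pM2r ?invr_gt0 //.
  by apply: (@le_trans _ _ (lambda n)); rewrite ?laminc // ler_peMr // ltW.
(* The requirement [2 <= Q] serves here: [t <= 2] and [lambda n <= lambda N] keep these initial
   times below [Q]. *)
apply: le_trans Q2; rewrite ler_pdivrMr // mulrC; apply: ler_pM => //.
- by lra.
- exact: ltW.
- by rewrite laminc ltnW.
Qed.
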